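(* Let $p,q$ be relatively prime integers with $p>q>0$. Then: (a) $p/q$ has a positive continued fraction expansion $p/q=[a_1,a_2,\ldots,a_n]$, which is unique up to replacing the coefficient $a_n$ by the two coefficients $a_n-1,1$. (b) If $p$ or $q$ is even, then $p/q$ has a unique even continued fraction expansion. (c) If $p$ and $q$ are both odd, then $p/q$ does not have an even continued fraction expansion.
   Context: $[c_1,\ldots,c_k]=c_1+1/(c_2+1/(\cdots+1/c_k))$. It is a positive continued fraction if every $c_i$ is a positive integer, and an even continued fraction if every $c_i$ is a nonzero even integer (possibly negative). *)

(* Defs.v *)
From mathcomp Require Import all_boot all_order all_algebra.

Set Implicit Arguments.
Unset Strict Implicit.
Unset Printing Implicit Defensive.

Import Order.TTheory GRing.Theory Num.Theory.
Local Open Scope ring_scope.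

(* The value at [::] is junk: expansions are required to be nonempty below.
   No tail of a positive (resp. even) continued fraction has value 0, since its
   value is >= 1 (resp. > 1 in absolute value), so the convention 0^-1 = 0 is
   never used for those. *)
Fixpoint cf_value (s : seq int) : rat :=
  match s with
  | [::] => 0
  | [:: c] => c%:~R
  | c :: s' => c%:~R + 1 / cf_value s'
  end.

Definition positive_cf (s : seq int) : bool :=
  (s != [::]) && all (fun c => 0 < c) s.

Definition even_cf (s : seq int) : bool :=
  (s != [::]) && all (fun c => (c != 0) && (2 %| c)%Z) s.

Definition positive_cf_expansion (x : rat) (s : seq int) : Prop :=
  positive_cf s /\ x = cf_value s.

Definition even_cf_expansion (x : rat) (s : seq int) : Prop :=
  even_cf s /\ x = cf_value s.

(* Main.v *)
Require Import Defs.
From mathcomp Require Import all_boot all_order all_algebra.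
From mathcomp Require Import zify lra.

(** Peeling off the first coefficient [c] of an expansion of [x] writes
    [x = c + e] with [e] the inverse of the value of the tail.  For positive
    coefficients [0 < e <= 1], with [e = 1] only for the tail [[1]], so [c] is
    the floor of [x] except for the final ambiguity [a = (a - 1) + 1/1].  For
    even coefficients [-1 < e < 1], so [c] is the only even integer at distance
    less than [1] from [x].  Both expansions exist by Euclid's algorithm, with
    an even quotient in the second case; an even quotient with [|r| < |q|] fails
    to exist only if [p] is an odd multiple of [q].  Finally
    [(p, q) -> (q, p - c q)] with [c] even keeps both entries odd, which is
    impossible at the last step [p = c q]. *)

Set Implicit Arguments.
Unset Strict Implicit.
Unset Printing Implicit Defensive.

Import Order.TTheory GRing.Theory Num.Theory.
Local Open Scope ring_scope.

Lemma cf_value_cons (c : int) (s : seq int) :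
  s != [::] -> cf_value (c :: s) = c%:~R + (cf_value s)^-1.
Proof. by case: s => //= d s _; rewrite div1r. Qed.

Lemma rcons_neq_nil (T : eqType) (s : seq T) (a : T) : rcons s a != [::].
Proof. by case: s. Qed.

(** Moves a strict bound on a difference of coefficients from the rationals to the integers, where
    it leaves few or no possible values. *)
Lemma intr_sub_lt (R : numDomainType) (c d k : int) :
  c%:~R - d%:~R < k%:~R :> R -> c - d < k.
Proof. by rewrite -intrB ltr_int. Qed.

Lemma positive_cf_cons (c : int) (s : seq int) : s != [::] ->
  positive_cf (c :: s) = (0 < c) && positive_cf s.
Proof. by case: s. Qed.

Lemma even_cf_cons (c : int) (s : seq int) : s != [::] ->
  even_cf (c :: s) = [&& c != 0, (2 %| c)%Z & even_cf s].
Proof. by case: s => // d s _; rewrite /even_cf /= !andbA. Qed.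

(** Isolates [[:: 1]], the only tail whose inverse is not strictly between 0 and 1 and hence the
    sole source of non-uniqueness. *)
Lemma positive_cf_eq1_or_gt1 (s : seq int) :
  positive_cf s -> s = [:: 1] \/ 1 < cf_value s.
Proof.
elim: s => // c s IHs; have [-> | s0] := eqVneq s [::].
  rewrite /positive_cf /= andbT => c0.
  have [->|c1] := eqVneq c 1; first by left.
  by right; rewrite (ltr_int rat 1); lia.
rewrite positive_cf_cons // => /andP[c0 sP]; right.
have s1 : 0 < cf_value s by case: (IHs sP) => [-> | /(lt_trans _)->].
rewrite cf_value_cons //; move: s1; rewrite -invr_gt0 => s1.
have : 1 <= c%:~R :> rat by rewrite (ler_int _ 1); lia.
by lra.
Qed.

Lemma cf_value_split_last (s : seq int) (a : int) :
  cf_value (s ++ [:: a - 1; 1]) = cf_value (rcons s a).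
Proof.
elim: s => [|c s IHs]; first by rewrite /= div1r invr1 intrB subrK.
rewrite rcons_cons cat_cons !cf_value_cons ?rcons_neq_nil ?IHs //.
by case: s {IHs}.
Qed.

Lemma positive_cf_rcons (s : seq int) (a : int) :
  positive_cf (rcons s a) = all (fun c => 0 < c) s && (0 < a).
Proof. by rewrite /positive_cf rcons_neq_nil all_rcons andTb andbC. Qed.

Lemma positive_cf_rcons_gt1 (s : seq int) (a : int) :
  positive_cf (rcons s a) -> 1 < a -> 1 < cf_value (rcons s a).
Proof.
move=> sP a1; case: (positive_cf_eq1_or_gt1 sP) => // /(congr1 (last 0)).
by rewrite last_rcons => /= a_eq; rewrite a_eq in a1.
Qed.

(** Euclid's algorithm, by induction on a bound for [q]. It stops at an exact division, whose
    quotient exceeds 1 because [q < p]; so the expansion produced is the one not ending in 1. *)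
Lemma positive_cf_exists (p q : int) : 0 < q -> q < p ->
  exists s a, [/\ positive_cf (rcons s a), 1 < a
    & cf_value (rcons s a) = p%:~R / q%:~R].
Proof.
have [n] := ubnP `|q|%N; elim: n p q => // n IHn p q qn q0 qp.
have q0R : q%:~R != 0 :> rat by rewrite intr_eq0; lia.
have rlt : (p %% q)%Z < q by rewrite ltz_pmod.
have rge : 0 <= (p %% q)%Z by rewrite modz_ge0; lia.
move: (p %/ q)%Z (p %% q)%Z (divz_eq p q) rlt rge => c r pE rlt rge.
have [r0 | r0] := eqVneq r 0.
  exists [::], c; have c1 : 1 < c by nia.
  split=> //; first by rewrite /positive_cf /= andbT; lia.
  by rewrite pE r0 addr0 intrM mulfK.
have [||| s [a [sP a1 sE]]] := IHn q r; try lia.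
exists (c :: s), a; rewrite rcons_cons.
have c0 : 0 < c by nia.
split=> //; first by rewrite positive_cf_cons ?rcons_neq_nil ?c0.
rewrite cf_value_cons ?rcons_neq_nil // sE pE intrD intrM invf_div.
by rewrite mulrDl mulfK.
Qed.

Lemma positive_cf_unique (s : seq int) (a : int) (t : seq int) :
  positive_cf (rcons s a) -> 1 < a -> positive_cf t ->
  cf_value t = cf_value (rcons s a) ->
  t = rcons s a \/ t = s ++ [:: a - 1; 1].
Proof.
move=> + a1; elim: s t => [|d s IHs] [|c t] // sP tP.
  have [-> /intr_inj -> | t0] := eqVneq t [::]; first by left.
  rewrite cf_value_cons // [RHS]/= => E; right.
  move: tP; rewrite positive_cf_cons // => /andP[c0 tP].
  case: (positive_cf_eq1_or_gt1 tP) => [t1 | t1].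
    move: E; rewrite t1 invr1 -(intrD _ c 1) => /intr_inj <-.
    by rewrite addrK.
  (* A tail above 1 would put the integer [a - c] strictly between 0 and 1. *)
  have ti0 : 0 < (cf_value t)^-1 by rewrite invr_gt0 (lt_trans _ t1).
  have ti1 : (cf_value t)^-1 < 1 by rewrite invf_lt1 // (lt_trans _ t1).
  have : a - c < 1 by apply: (@intr_sub_lt rat); lra.
  have : c - a < 0 by apply: (@intr_sub_lt rat); lra.
  by lia.
rewrite rcons_cons (cf_value_cons d (rcons_neq_nil s a)).
move: sP; rewrite rcons_cons positive_cf_cons ?rcons_neq_nil // => /andP[d0 sP].
have s1 := positive_cf_rcons_gt1 sP a1.
have si0 : 0 < (cf_value (rcons s a))^-1 by rewrite invr_gt0 (lt_trans _ s1).
have si1 : (cf_value (rcons s a))^-1 < 1 by rewrite invf_lt1 // (lt_trans _ s1).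
(* The value lies strictly between [d] and [d + 1], so it is no integer; this excludes an empty [t]
   here and [t = [:: 1]] below. *)
have [-> /= E | t0] := eqVneq t [::].
  have : d - c < 0 by apply: (@intr_sub_lt rat); lra.
  have : c - d < 1 by apply: (@intr_sub_lt rat); lra.
  by lia.
rewrite cf_value_cons // => E.
move: tP; rewrite positive_cf_cons // => /andP[c0 tP].
case: (positive_cf_eq1_or_gt1 tP) => [t1 | t1].
  move: E; rewrite t1 /= invr1 => E.
  have : d - c < 1 by apply: (@intr_sub_lt rat); lra.
  have : c - d < 0 by apply: (@intr_sub_lt rat); lra.
  by lia.
have ti0 : 0 < (cf_value t)^-1 by rewrite invr_gt0 (lt_trans _ t1).
have ti1 : (cf_value t)^-1 < 1 by rewrite invf_lt1 // (lt_trans _ t1).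
have cd : c = d.
  have : d - c < 1 by apply: (@intr_sub_lt rat); lra.
  have : c - d < 1 by apply: (@intr_sub_lt rat); lra.
  by lia.
move: E; rewrite cd => /addrI /invr_inj /(IHs _ sP tP) [->|->]; by [left|right].
Qed.

Lemma even_cf_norm_gt1 (s : seq int) : even_cf s -> 1 < `|cf_value s|.
Proof.
have norm_ge2 (c : int) : c != 0 -> (2 %| c)%Z -> 2 <= `|c%:~R| :> rat.
  by move=> c0 c2; rewrite -intr_norm (ler_int _ 2); lia.
elim: s => // c s IHs; have [-> | s0] := eqVneq s [::].
  rewrite /even_cf /= andbT => /andP[c0 c2].
  by apply: lt_le_trans (norm_ge2 c c0 c2).
rewrite even_cf_cons // cf_value_cons // => /and3P[c0 c2 /IHs s1].
have si1 : `|(cf_value s)^-1| < 1.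
  by rewrite normfV invf_lt1 // (lt_trans _ s1).
have := norm_ge2 c c0 c2.
have := lerB_normD c%:~R (cf_value s)^-1.
by lra.
Qed.

Lemma even_cf_inv_bounds (s : seq int) :
  even_cf s -> -1 < (cf_value s)^-1 < 1.
Proof.
move=> /even_cf_norm_gt1 s1.
by rewrite -ltr_norml normfV invf_lt1 // (lt_trans _ s1).
Qed.

Lemma even_cf_neq0 (s : seq int) : even_cf s -> cf_value s != 0.
Proof. by move/even_cf_norm_gt1=> s1; rewrite -normr_gt0 (lt_trans _ s1). Qed.

Lemma even_cf_unique (s t : seq int) :
  even_cf s -> even_cf t -> cf_value s = cf_value t -> s = t.
Proof.
(* The empty tail is treated as [e = 0]. Since [e] is nonzero for every other tail, equal values of
   [e] force both tails to be empty or neither. *)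
have tail (c : int) (u : seq int) : even_cf (c :: u) -> exists2 e : rat,
    cf_value (c :: u) = c%:~R + e &
    [/\ (2 %| c)%Z, -1 < e < 1 & if u == [::] then e = 0
       else [/\ even_cf u, e = (cf_value u)^-1 & e != 0]].
  have [-> | u0] := eqVneq u [::].
    by case/and3P=> _ /andP[_ c2] _; exists 0; rewrite ?addr0.
  rewrite even_cf_cons // => /and3P[c0 c2 uP].
  exists (cf_value u)^-1; first by rewrite cf_value_cons.
  by split=> //; [exact: even_cf_inv_bounds | rewrite invr_eq0 even_cf_neq0].
elim: s t => [|c s IHs] [|d t] //.
move=> /tail[e -> [c2 /andP[e1 e2] sP]] /tail[f -> [d2 /andP[f1 f2] tP]] E.
(* Two even integers at distance less than 2 coincide. *)
have cd : c = d.
  have : d - c < 2 by apply: (@intr_sub_lt rat); lra.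
  have : c - d < 2 by apply: (@intr_sub_lt rat); lra.
  by lia.
move: E; rewrite cd => /addrI ef; congr cons; move: sP tP; rewrite -ef.
have [-> | _] := eqVneq s [::]; have [-> | _] := eqVneq t [::] => //.
- by move=> -> [_ _]; rewrite eqxx.
- by move=> [_ _ /eqP].
by move=> [sP -> _] [tP /invr_inj E _]; apply: IHs.
Qed.

(** Clearing the denominator, with [p] and [q] arbitrary, lets the induction pass to the pair [q],
    [p - c * q] for the tail. *)
Lemma even_cf_not_odd (s : seq int) (p q : int) : even_cf s ->
  cf_value s * q%:~R = p%:~R -> (2 %| p)%Z \/ (2 %| q)%Z.
Proof.
elim: s p q => // c s IHs p q; have [-> | s0] := eqVneq s [::].
  case/and3P=> _ /andP[_ c2] _ /=.
  by rewrite -intrM => /intr_inj <-; left; rewrite dvdz_mulr.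
rewrite even_cf_cons // cf_value_cons // => /and3P[_ c2 sP] E.
have [] // := IHs q (p - c * q) sP.
- rewrite intrB intrM -E mulrDl addrAC subrr add0r mulrA divff ?mul1r //.
  exact: even_cf_neq0.
- by right.
by move=> pcq; left; rewrite -(subrK (c * q) p) rpredD // dvdz_mulr.
Qed.

(** Divide by [2 * q] and, if the remainder exceeds [|q|], shift it by one multiple of [2 * q]. A
    remainder equal to [|q|] is the exceptional case, rewritten as [q] whatever its sign. *)
Lemma even_quotient (p q : int) : q != 0 ->
  exists c r, [/\ p = c * q + r, (2 %| c)%Z & `|r| < `|q| \/ r = q].
Proof.
move=> q0; have q20 : 2 * q != 0 by lia.
move: (p %/ (2 * q))%Z (p %% (2 * q))%Z (divz_eq p (2 * q)) (ltz_mod p q20)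
  (modz_ge0 p q20) => k r pE rlt rge.
have [r1 | r1] := ltP r `|q|.
  by exists (2 * k), r; split; [lia | rewrite dvdz_mulr | left; lia].
have [r2 | r2] := eqVneq r `|q|.
  have [q1 | q1] := leP 0 q.
    by exists (2 * k), q; split; [lia | rewrite dvdz_mulr | right].
  by exists (2 * (k - 1)), q; split; [lia | rewrite dvdz_mulr | right].
have [q1 | q1] := leP 0 q.
  by exists (2 * (k + 1)), (r - 2 * q); split; [lia | rewrite dvdz_mulr | left; lia].
by exists (2 * (k - 1)), (r + 2 * q); split; [lia | rewrite dvdz_mulr | left; lia].
Qed.

Lemma coprimez_dvd_unit (p q : int) : coprimez p q -> (q %| p)%Z -> `|q| = 1.
Proof.
rewrite /coprimez => /eqP pq qp; have : (q %| gcdz p q)%Z by rewrite dvdz_gcd qp dvdzz.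
by rewrite pq dvdz1 => /eqP; lia.
Qed.

Lemma even_cf_exists (p q : int) : coprimez p q -> q != 0 -> `|q| < `|p| ->
  (2 %| p)%Z \/ (2 %| q)%Z -> exists s, even_cf_expansion (p%:~R / q%:~R) s.
Proof.
have [n] := ubnP `|q|%N; elim: n p q => // n IHn p q qn cop q0 qp par.
have q0R : q%:~R != 0 :> rat by rewrite intr_eq0.
have [c [r [pE c2 rq]]] := even_quotient p q0.
have par' : (2 %| q)%Z \/ (2 %| r)%Z.
  case: par; last by left.
  by rewrite pE rpredDl ?dvdz_mulr //; right.
(* If [r = q], then [q] is even and divides [p], whereas coprimality makes it a unit. *)
have {}rq : `|r| < `|q|.
  case: rq => // rq; have q2 : (2 %| q)%Z by case: par'; rewrite ?rq.
  have /(coprimez_dvd_unit cop) : (q %| p)%Z by rewrite pE rq rpredD // dvdz_mull.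
  by lia.
(* A zero quotient would give [p = r], smaller than [q] in absolute value. *)
have c0 : c != 0 by apply: contraTneq qp => c0; rewrite pE c0; lia.
have [r0 | r0] := eqVneq r 0.
  exists [:: c]; split; first by rewrite /even_cf /= c0 c2.
  by rewrite pE r0 addr0 intrM mulfK.
have cop' : coprimez q r.
  by move: cop; rewrite pE /coprimez gcdzC gcdzMDl.
have [||| s [sP sE]] := IHn q r _ cop' r0; try by [lia].
have s0 : s != [::] by case: s sP {sE}.
exists (c :: s); split; first by rewrite even_cf_cons // c0 c2.
by rewrite cf_value_cons // -sE pE intrD intrM invf_div mulrDl mulfK.
Qed.

Theorem proposition2p3 (p q : int) (cop_pq : coprimez p q)
    (q_gt0 : 0 < q) (q_lt_p : q < p) :
  [/\ (exists (s : seq int) (a : int),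
         positive_cf_expansion (p%:~R / q%:~R) (rcons s a) /\
         (forall t : seq int,
            positive_cf_expansion (p%:~R / q%:~R) t <->
            t = rcons s a \/ t = s ++ [:: a - 1; 1])),
      ((2 %| p)%Z \/ (2 %| q)%Z ->
         exists! s : seq int, even_cf_expansion (p%:~R / q%:~R) s)
    & (~~ (2 %| p)%Z /\ ~~ (2 %| q)%Z ->
         ~ exists s : seq int, even_cf_expansion (p%:~R / q%:~R) s)].
Proof.
split.
- have [s [a [sP a1 sE]]] := positive_cf_exists q_gt0 q_lt_p.
  exists s, a; split=> [|t]; first by split.
  split=> [[tP tE] | [-> | ->]]; first by apply: positive_cf_unique; rewrite // sE.
    by split.
  split; last by rewrite cf_value_split_last.
  (* The new coefficient [a - 1] is positive because [1 < a]. *)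
  move: sP; rewrite positive_cf_rcons /positive_cf all_cat => /andP[-> _] /=.
  by case: s {sE} => //=; lia.
- move=> par.
  have [|| s [sP sE]] := even_cf_exists cop_pq _ _ par; try lia.
  by exists s; split=> // t [tP tE]; apply: even_cf_unique; rewrite // -sE.
move=> [podd qodd] [s [sP sE]].
have q0 : q%:~R != 0 :> rat by rewrite intr_eq0; lia.
have [] := even_cf_not_odd (p := p) (q := q) sP; first by rewrite -sE divfK.
  exact/negP.
exact/negP.
Qed.
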